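(* Let $\Gamma$ be a finitely generated group. If $\Gamma$ has polynomial containment, then $\Gamma$ is amenable.
   Context: Let $G$ be a connected, locally finite graph, with combinatorial metric $\mathrm{dist}_G$ on its vertices ($\mathrm{dist}_G(x,y)$ is the length of a shortest edge-path from $x$ to $y$), and let $d$ be a non-negative integer. The graph $G$ has polynomial containment of degree at most $d$ if there is a constant $C>0$ such that for every finite set $X_0$ of vertices of $G$ there is a sequence $\{W_k : k\ge 1\}$ of subsets of vertices of $G$ such that: (1) for every $n\ge 1$, $|W_n|\le Cn^d$; (2) $X_n\cap W_{n+1}=\emptyset$ for every $n\ge 0$, where for $n\geq 1$ the set $X_n$ is defined recursively as the set of vertices at distance at most one from $X_{n-1}$ that do not belong to $W_1\cup\cdots\cup W_n$; (3) there is an integer $T>0$ such that $X_n=X_T$ for every $n\ge T$. A finitely generated group has polynomial containment of degree at most $d$ if its Cayley graph with respect to a finite generating set has polynomial containment of degree at most $d$ (this does not depend on the choice of finite generating set, since the property is preserved by quasi-isometry among connected graphs of bounded degree). A finitely generated group has polynomial containment if it has polynomial containment of degree at most $d$ for some non-negative integer $d$. The Cheeger constant of a locally finite graph $G$ is $h(G)=\inf_K |\partial K|/|K|$, where $K$ ranges over non-empty finite subsets of vertices of $G$ and $\partial K$ is the set of edges of $G$ with one endpoint in $K$ and the other endpoint not in $K$. The graph $G$ is amenable if $h(G)=0$ and non-amenable otherwise. A finitely generated group is amenable if its Cayley graph with respect to a finite generating set is amenable (this is independent of the finite generating set), and non-amenable otherwise. *)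

(* Defs.v *)
From mathcomp Require Import all_boot all_order all_algebra.
From mathcomp Require Import finmap.
From mathcomp Require Import boolp classical_sets reals.

Set Implicit Arguments.
Unset Strict Implicit.
Unset Printing Implicit Defensive.

Import Order.TTheory GRing.Theory Num.Theory.

Local Open Scope fset_scope.
Local Open Scope classical_set_scope.
Local Open Scope ring_scope.

(* Simple graphs: local finiteness is built into the type of [nbr], which sends
   a vertex to its finite set of neighbours. Loops and multiple edges are
   excluded. *)
Record graph := Graph {
  vertex :> choiceType;
  nbr : vertex -> {fset vertex};
  nbr_irr : forall x, x \notin nbr x;
  nbr_sym : forall x y, (y \in nbr x) = (x \in nbr y);
  graph_inhabited : inhabited vertex;
  graph_connected : forall x y : vertex,
    exists2 p : seq vertex, path (fun u v => v \in nbr u) x p & last x p = y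
}.

Section Graph.
Variable G : graph.
Implicit Types (x y : G) (K : {fset G}).

Definition adj : rel G := fun x y => y \in nbr x.

(* [x :: p] lists the successive vertices, so [size p] is the number of edges. *)
Definition walk x y (n : nat) : Prop :=
  exists p : seq G, [/\ path adj x p, last x p = y & size p = n].

Lemma walk_ex x y : exists n, `[< walk x y n >].
Proof.
have [p px pl] := graph_connected x y.
by exists (size p); apply/asboolP; exists p.
Qed.

Definition dist x y : nat := ex_minn (walk_ex x y).

(* [W] is indexed from 1: the value [W 0] is never used. *)
Fixpoint burning (X0 : {fset G}) (W : nat -> {fset G}) (n : nat) : set G :=
  if n is m.+1 then
    [set y | (exists2 x, burning X0 W m x & (dist x y <= 1)%N)
           /\ forall i, (1 <= i <= n)%N -> y \notin W i]
  else [set` X0].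

Definition polynomial_containment_deg (R : realType) (d : nat) : Prop :=
  exists2 C : R, 0 < C &
  forall X0 : {fset G}, exists W : nat -> {fset G},
  [/\ forall n, (1 <= n)%N -> #|` W n|%:R <= C * n%:R ^+ d,
      forall n, burning X0 W n `&` [set` W n.+1] = set0
    & exists2 T, (0 < T)%N &
        forall n, (T <= n)%N -> burning X0 W n = burning X0 W T].

(* An undirected edge is the unordered pair [[fset x; y]]. *)
Definition edge_boundary K : {fset {fset G}} :=
  [fset [fset x; y] | x in K, y in [fset y in nbr x | y \notin K]].

(* [graph_inhabited] makes the set below nonempty, and it is bounded below by 0,
   so [inf] is the genuine infimum. *)
Definition cheeger (R : realType) : R :=
  inf [set #|` edge_boundary K|%:R / #|` K|%:R | K in [set K | K != fset0]].

Definition amenable_graph (R : realType) : Prop := cheeger R = 0.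

End Graph.

Section Group.
Variable gT : groupType.
Implicit Types (S : {fset gT}) (x y : gT).
Local Open Scope group_scope.

Definition generates S : Prop :=
  forall x, exists2 w : seq gT,
    {in w, forall s, (s \in S) || (s^-1 \in S)} & x = \prod_(s <- w) s.

Definition finitely_generated : Prop := exists S, generates S.

Definition cayley_nbr S x : {fset gT} :=
  [fset y in [fset x * s | s in S] `|` [fset x * s^-1 | s in S] | y != x]%fset.

Lemma in_cayley_nbr S x y : (y \in cayley_nbr S x) =
  (y != x) && ((x^-1 * y \in S) || (y^-1 * x \in S)).
Proof.
rewrite !inE /= andbC; congr (_ && (_ || _)).
  apply/imfsetP/idP => /= [[s sS ->]|h]; first by rewrite mulKg.
  by exists (x^-1 * y); rewrite ?mulVKg.
apply/imfsetP/idP => /= [[s sS ->]|h]; first by rewrite invgM invgK mulgVK.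
by exists (y^-1 * x); rewrite // invgM invgK mulVKg.
Qed.

Lemma cayley_nbr_irr S x : x \notin cayley_nbr S x.
Proof. by rewrite in_cayley_nbr eqxx. Qed.

Lemma cayley_nbr_sym S x y : (y \in cayley_nbr S x) = (x \in cayley_nbr S y).
Proof. by rewrite !in_cayley_nbr eq_sym orbC. Qed.

Lemma cayley_connected S : generates S -> forall x y,
  exists2 p : seq gT, path (fun u v => v \in cayley_nbr S u) x p & last x p = y.
Proof.
move=> genS x y; have [w wS xy] := genS (x^-1 * y).
have -> : y = x * \prod_(s <- w) s by rewrite -xy mulVKg.
elim: w x wS {xy} => [|s w IH] x wS.
  by exists [::]; rewrite //= big_nil mulg1.
have wS' : {in w, forall s, (s \in S) || (s^-1 \in S)}.
  by move=> t tw; apply: wS; rewrite inE tw orbT.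
have [p pp pl] := IH (x * s) wS'.
rewrite big_cons mulgA.
have [s1|s1] := eqVneq s 1.
  by exists p; move: pp pl; rewrite s1 !mulg1.
exists (x * s :: p) => //=; rewrite pp andbT in_cayley_nbr.
rewrite mulKg invgM mulgVK wS ?inE ?eqxx // andbT.
by apply: contra s1 => /eqP e; rewrite -[s](mulKg x) e mulVg.
Qed.

Definition cayley S (genS : generates S) : graph :=
  @Graph gT (cayley_nbr S) (cayley_nbr_irr S) (@cayley_nbr_sym S)
    (inhabits 1) (cayley_connected genS).

Definition group_polynomial_containment_deg (R : realType) (d : nat) : Prop :=
  exists S, exists genS : generates S,
    polynomial_containment_deg (cayley genS) R d.

Definition group_polynomial_containment (R : realType) : Prop :=
  exists d : nat, group_polynomial_containment_deg R d.

(* For a finitely generated group neither this property nor the one above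
   depends on the finite generating set. The quantifiers are chosen so that an
   implication from the former to the latter makes no use of that fact: some
   generating set there, all of them here. When [gT] is not finitely generated
   this holds vacuously. *)
Definition amenable (R : realType) : Prop :=
  forall S (genS : generates S), amenable_graph (cayley genS) R.

End Group.

(* Main.v *)
Require Import Defs.
From mathcomp Require Import all_boot all_order all_algebra.
From mathcomp Require Import finmap lra.
From mathcomp Require Import boolp classical_sets reals.

(** The proof goes by contraposition: on a graph with vertex expansion, a large
enough initial fire outruns any polynomial supply of protected vertices.

Let [e > 0], and suppose that every finite [K] has at least [e * #|K|] vertices
adjacent to it but outside it. One time step replaces the burning set [X_n] by
its closed neighbourhood minus the sets [W_1, ..., W_(n+1)], which together have
at most [C * (n+1)^(d+1)] vertices. Hence
[#|X_(n+1)| >= (1 + e) * #|X_n| - C * (n+1)^(d+1)]. Put [q = 1 + e/2]. Since [q^n]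
dominates every polynomial, an initial set large enough makes the loss at most
[(e/2) * M * q^n <= (e/2) * #|X_n|] for a suitable constant [M]; then
[#|X_n| >= M * q^n] propagates by induction and [X_n] grows strictly for ever,
so the fire never stabilises ([vertex_expansion_not_contained]). Expansion
itself provides the large initial set, since a nonempty finite set has a
nonempty outer boundary ([vertex_expansion_large]).

It remains to pass from a positive Cheeger constant to vertex expansion, and
here the two may refer to different generating sets [S'] and [S]. Call [x] in
[K] escaping along [g] when [x * g] is outside [K]. The edge boundary for [S']
is counted by the points escaping along the elements of [S'] and their inverses.
Each of these is a word in [S], and a point escaping along a word of length [l]
must leave [K] at one of its [l] letters; as right multiplication is injective,
the number of such points is at most [l] times the size of the outer boundary
of [K] for [S] ([card_escaping_le]). So the [S']-edge boundary is bounded by a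
constant multiple of the [S]-outer boundary ([cheeger_vertex_expansion]). *)

Set Implicit Arguments.
Unset Strict Implicit.
Unset Printing Implicit Defensive.

Import Order.TTheory GRing.Theory Num.Theory.

Local Open Scope fset_scope.
Local Open Scope ring_scope.

(** * Cardinality and growth estimates *)

Lemma leq_card_bigfcup (I : Type) (T : choiceType) (r : seq I)
    (F : I -> {fset T}) :
  (#|` \bigcup_(i <- r) F i| <= \sum_(i <- r) #|` F i|)%N.
Proof.
elim: r => [|i r IH]; first by rewrite !big_nil cardfs0.
rewrite !big_cons (leq_trans _ (leq_add (leqnn _) IH)) //.
by rewrite -cardfsUI leq_addr.
Qed.

(** Writing [q] as the square of [r], one factor [r ^+ n] absorbs one factor
[n.+1], with constant [1 + (r - 1)^-1], and the other absorbs the remaining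
power by induction on the degree. *)
Lemma polynomial_le_exponential (R : rcfType) (q : R) (k : nat) :
  1 < q -> exists2 A : R, 0 < A & forall n, n.+1%:R ^+ k <= A * q ^+ n.
Proof.
elim: k q => [|k IH] q q1.
  by exists 1 => // n; rewrite mul1r expr0 exprn_ege1 // ltW.
have r1 : 1 < Num.sqrt q by rewrite -sqrtr1 ltr_sqrt // (lt_trans ltr01).
set r := Num.sqrt q in r1.
have rr n : q ^+ n = r ^+ n * r ^+ n.
  by rewrite -exprMn -expr2 sqr_sqrtr // (le_trans ler01 (ltW q1)).
have [A A0 hA] := IH r r1.
have B0 : 0 < 1 + (r - 1)^-1 by rewrite addr_gt0 ?invr_gt0 ?subr_gt0.
have hB n : n.+1%:R <= (1 + (r - 1)^-1) * r ^+ n.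
  elim: n => [|n hn]; first by rewrite expr0 mulr1 lerDl invr_ge0 subr_ge0 ltW.
  have rn : 1 <= r ^+ n by rewrite exprn_ege1 // ltW.
  have Br : (1 + (r - 1)^-1) * (r - 1) = r.
    by rewrite mulrDl mul1r mulVf ?subrK // subr_eq0 gt_eqF.
  have -> : (1 + (r - 1)^-1) * r ^+ n.+1 =
            (1 + (r - 1)^-1) * r ^+ n + r * r ^+ n.
    by rewrite exprS mulrA -mulrDl; congr (_ * _); lra.
  rewrite -[n.+2]addn1 natrD lerD // mulr_ege1 //; exact: ltW.
exists ((1 + (r - 1)^-1) * A); first exact: mulr_gt0.
by move=> n; rewrite exprS rr mulrACA ler_pM // exprn_ge0.
Qed.

(** * Fires on graphs with vertex expansion *)

Section Firefighter.
Variable G : graph.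
Implicit Types (x y : G) (K X : {fset G}) (W : nat -> {fset G}).

Definition outer_boundary K : {fset G} := (\bigcup_(x <- K) nbr x) `\` K.

Lemma outer_boundaryP K y :
  reflect (y \notin K /\ exists2 x, x \in K & y \in nbr x)
          (y \in outer_boundary K).
Proof.
rewrite inE; apply: (iffP andP) => -[yK h]; split=> //.
  by case/bigfcupP: h => x /andP[xK _] yx; exists x.
by case: h => x xK yx; apply/bigfcupP; exists x; rewrite ?xK.
Qed.

Definition vertex_expansion (R : realType) (e : R) : Prop :=
  forall K, e * #|` K|%:R <= #|` outer_boundary K|%:R.

Lemma card_closed_neighbourhood K :
  #|` K `|` outer_boundary K| = (#|` K| + #|` outer_boundary K|)%N.
Proof.
rewrite -cardfsUI -[LHS]addn0; congr addn; symmetry; apply/eqP.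
rewrite cardfs_eq0 -fsubset0; apply/fsubsetP => y.
by rewrite !inE => /and3P[-> ].
Qed.

Lemma dist_le1 x y : (dist x y <= 1)%N = (y == x) || (y \in nbr x).
Proof.
rewrite /dist; case: ex_minnP => n /asboolP[p [px pl pn]] nmin.
apply/idP/orP => [n1|[/eqP e|yx]].
- case: p px pl pn => [_ <- _|z [|? ?] /=]; first by left.
    by rewrite andbT => xz <- _; right.
  by move=> _ _ e; rewrite -e in n1.
- by rewrite (leq_trans (nmin 0%N _)) //; apply/asboolP; exists [::]; rewrite e.
- by apply: nmin; apply/asboolP; exists [:: y]; split; rewrite //= /adj yx.
Qed.

(** The burning sets as finite sets, so that they have a cardinality. *)
Fixpoint burnt X W n : {fset G} :=
  if n is m.+1 then
    (burnt X W m `|` outer_boundary (burnt X W m))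
      `\` \bigcup_(i <- index_iota 1 n.+1) W i
  else X.

Lemma burningE X W n : burning X W n = [set` burnt X W n]%classic.
Proof.
elim: n => // n IH; apply/seteqP; split=> y /=; rewrite IH /=.
- case=> -[x xX]; rewrite dist_le1 => xy hW; rewrite 2!inE.
  apply/andP; split.
    apply/negP => /bigfcupP[i]; rewrite andbT mem_index_iota => /hW.
    by move=> /negP.
  rewrite -/(burnt X W n).
  have [//|yX] := boolP (y \in burnt X W n).
  apply/outer_boundaryP; split=> //; exists x => //.
  by case/orP: xy => // /eqP e; rewrite e xX in yX.
- rewrite 2!inE -/(burnt X W n) => /andP[/negP yW h]; split; last first.
    move=> i hi; apply/negP => yi; apply: yW; apply/bigfcupP.
    by exists i; rewrite ?mem_index_iota ?hi.
  case/orP: h => [yX|/outer_boundaryP[_ [x xX xy]]].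
    by exists y; rewrite ?dist_le1 ?eqxx.
  by exists x; rewrite ?dist_le1 ?xy ?orbT.
Qed.

(** The protected vertices are the only ones missing from the closed
neighbourhood of the previous burning set. *)
Lemma card_burntS X W n :
  (#|` burnt X W n| + #|` outer_boundary (burnt X W n)|
     <= #|` burnt X W n.+1| + \sum_(1 <= i < n.+2) #|` W i|)%N.
Proof.
rewrite -card_closed_neighbourhood /=.
set N := _ `|` _; set U := \bigcup_(i <- _) _.
rewrite -(cardfsID U N) addnC leq_add2l.
apply: leq_trans (leq_card_bigfcup _ _).
by rewrite fsubset_leq_card // fsubsetIr.
Qed.

(** Iterating closed neighbourhoods from one vertex adds at least one vertex at
each step, because expansion gives any nonempty set a nonempty outer
boundary. *)
Lemma vertex_expansion_large (R : realType) (e : R) (m : nat) :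
  0 < e -> vertex_expansion e -> exists K, (m < #|` K|)%N.
Proof.
move=> e0 eG; elim: m => [|m [K mK]].
  by have [x] := graph_inhabited G; exists [fset x]; rewrite cardfs1.
exists (K `|` outer_boundary K).
rewrite card_closed_neighbourhood -[m.+2]addn1 leq_add //.
rewrite -(ltr_nat R); apply: lt_le_trans (eG K).
by rewrite mulr_gt0 // ltr0n (leq_trans _ mK).
Qed.

(** Half of the expansion rate [e] pays for the protected vertices; the other
half keeps the fire growing geometrically. *)
Theorem vertex_expansion_not_contained (R : realType) (e : R) (d : nat) :
  0 < e -> vertex_expansion e -> ~ polynomial_containment_deg G R d.
Proof.
move=> e0 eG [C C0 contain].
pose q := 1 + e / 2.
have q1 : 1 < q by rewrite /q; lra.
have [A A0 hA] := polynomial_le_exponential d.+1 q1.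
(* [M] is chosen so that [e / 2 * M * q ^+ n = C * A * q ^+ n], which bounds the
   number of vertices protected up to time [n.+1]. *)
pose M := A * C / (e / 2).
have M0 : 0 < M by rewrite !(mulr_gt0, invr_gt0).
have [X MX] : exists X : {fset G}, M < #|` X|%:R.
  have [X hX] := vertex_expansion_large (Num.truncn M) e0 eG.
  by exists X; apply: lt_le_trans (truncnS_gt M) _; rewrite ler_nat.
have [W [Wd _ [T T0 stop]]] := contain X.
pose b n : R := #|` burnt X W n|%:R.
have sumW n : (\sum_(1 <= i < n.+2) #|` W i|)%:R <= e / 2 * (M * q ^+ n).
  have -> : e / 2 * (M * q ^+ n) = C * (A * q ^+ n).
    have e2 : e / 2 != 0 by rewrite gt_eqF ?divr_gt0.
    by rewrite mulrA /M [e / 2 * _]mulrC divfK // [A * C]mulrC mulrA.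
  apply: le_trans (ler_wpM2l (ltW C0) (hA n)).
  rewrite natr_sum exprS mulrCA mulr_natl.
  have -> : n.+1 = (n.+2 - 1)%N by rewrite subn1.
  rewrite -sumr_const_nat big_nat [leRHS]big_nat ler_sum // => i /andP[i0 ilt].
  apply: le_trans (Wd i i0) _.
  by rewrite ler_pM2l // lerXn2r ?nnegrE // ler_nat subn1.
have grow n : b n + e * b n <= b n.+1 + e / 2 * (M * q ^+ n).
  apply: le_trans (lerD (lexx _) (eG _)) _.
  apply: le_trans (lerD (lexx _) (sumW n)).
  by rewrite -!natrD ler_nat card_burntS.
have big n : M * q ^+ n <= b n.
  elim: n => [|n IH]; first by rewrite expr0 mulr1 ltW.
  rewrite exprSr mulrA /q mulrDr mulr1.
  move: (grow n) (ler_wpM2r (ltW e0) IH); set u := M * _ in IH *; nra.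
have bT : b T.+1 = b T.
  have := stop T.+1 (leqnSn T); rewrite !burningE => bE.
  congr (#|` _|%:R); apply/fsetP => y.
  by have /= yE := congr1 (fun S => S y) bE; apply/idP/idP; rewrite /= yE.
(* At time [T] the expansion [e * b T] would have to be eaten up by a loss of at
   most [e / 2 * b T]. *)
have := grow T; rewrite bT; apply/negP; rewrite -ltNge ltrD2l.
apply: le_lt_trans (ler_wpM2l _ (big T)) _; first lra.
rewrite ltr_pM2r; first lra.
apply: lt_le_trans (big T).
by rewrite mulr_gt0 // exprn_gt0 // (lt_trans ltr01).
Qed.

End Firefighter.

(** * The Cheeger constant *)

Lemma cheeger_le (G : graph) (R : realType) (K : {fset G}) :
  cheeger G R * #|` K|%:R <= #|` edge_boundary K|%:R.
Proof.
have [->|K0] := eqVneq K fset0; first by rewrite cardfs0 mulr0 ler0n.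
rewrite -ler_pdivlMr ?ltr0n ?cardfs_gt0 //; apply: ge_inf; last by exists K.
by exists 0 => _ [L _ <-]; rewrite divr_ge0.
Qed.

Lemma cheeger_ge0 (G : graph) (R : realType) : 0 <= cheeger G R.
Proof.
apply: lb_le_inf; last by move=> _ [L _ <-]; rewrite divr_ge0.
have [x] := graph_inhabited G.
exists (#|` edge_boundary [fset x]|%:R / #|` [fset x]|%:R), [fset x] => //=.
by rewrite -cardfs_gt0 cardfs1.
Qed.

(** * Edge boundaries and outer boundaries in Cayley graphs *)

Section Cayley.
Variable gT : groupType.
Implicit Types (S K : {fset gT}) (x g : gT).
Local Open Scope group_scope.

Definition escaping K g : {fset gT} := [fset x in K | x * g \notin K].

Lemma escaping1 K : escaping K 1 = fset0.
Proof. by apply/fsetP => x; rewrite !inE mulg1 andbN. Qed.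

Lemma card_mulr K s : #|` [fset x * s | x in K]| = #|` K|.
Proof. by apply: card_imfset; apply: mulIg. Qed.

(** If [x] escapes along [s * g], then either [x * s] is already outside [K], or
[x * s] is in [K] and escapes along [g]. *)
Lemma card_escapingM K s g :
  (#|` escaping K (s * g)| <= #|` escaping K s| + #|` escaping K g|)%N.
Proof.
rewrite -(card_mulr (escaping _ (_ * _)) s) -(card_mulr (escaping K s) s).
rewrite (leq_trans
  (n := #|` [fset x * s | x in escaping K s] `|` escaping K g|)) //.
  apply: fsubset_leq_card; apply/fsubsetP => _ /imfsetP[x /= xe ->].
  move: xe; rewrite !inE mulgA => /andP[xK xsg].
  have [xs|xs] := boolP (x * s \in K); first by rewrite xsg orbT.
  by apply/orP; left; apply/imfsetP; exists x; rewrite // !inE xK.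
by rewrite -cardfsUI leq_addr.
Qed.

Section Generators.
Variables (S : {fset gT}) (genS : generates S).
Local Notation ob K := (#|` outer_boundary (K : {fset cayley genS})|).

(** Right multiplication by [s] moves each escaping point along an edge, hence
injects the points escaping along [s] into the outer boundary. *)
Lemma card_escaping_gen K s :
  (s \in S) || (s^-1 \in S) -> (#|` escaping K s| <= ob K)%N.
Proof.
move=> sS; rewrite -(card_mulr _ s).
apply: fsubset_leq_card; apply/fsubsetP => _ /imfsetP[x /= xe ->].
have /andP[xK xs] : (x \in K) && (x * s \notin K) by move: xe; rewrite !inE.
apply/(@outer_boundaryP (cayley genS)); split=> //; exists x => //=.
rewrite in_cayley_nbr mulKg invgM mulgVK sS andbT.
by apply: contraNneq xs => ->.
Qed.

(** The bound is the length of a word for [g], hence uniform in [K]. *)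
Lemma card_escaping_le g :
  exists n, forall K, (#|` escaping K g| <= n * ob K)%N.
Proof.
have [w wS ->] := genS g; exists (size w) => K.
elim: w wS => [|s w IH] wS; first by rewrite big_nil escaping1 cardfs0.
rewrite big_cons mulSn (leq_trans (card_escapingM _ _ _)) // leq_add //.
  by rewrite card_escaping_gen // wS ?mem_head.
by apply: IH => t tw; rewrite wS // inE tw orbT.
Qed.

Lemma sum_card_escaping_le (r : seq gT) :
  exists n, forall K, (\sum_(g <- r) #|` escaping K g| <= n * ob K)%N.
Proof.
elim: r => [|g r [n hn]]; first by exists 0%N => K; rewrite big_nil.
have [m hm] := card_escaping_le g.
by exists (m + n)%N => K; rewrite big_cons mulnDl leq_add.
Qed.

End Generators.

(** Every boundary edge has the form [[fset x; x * g]], with [x] escaping along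
some [g] that is in [S] or inverse to an element of [S]. *)
Lemma card_edge_boundary_le S (genS : generates S) (K : {fset cayley genS}) :
  (#|` edge_boundary K| <=
     \sum_(g <- (S : seq gT) ++ [seq s^-1 | s <- S]) #|` escaping K g|)%N.
Proof.
pose F g : {fset {fset gT}} := [fset [fset x; x * g] | x in escaping K g].
apply: (@leq_trans (\sum_(g <- (S : seq gT) ++ [seq s^-1 | s <- S]) #|` F g|)).
  2: by apply: leq_sum => g _; exact: leq_imfset_card.
apply: leq_trans (leq_card_bigfcup _ F).
apply: fsubset_leq_card; apply/fsubsetP => e /imfset2P[x /= xK [y + ->]].
rewrite inE => /andP[xy yK].
apply/bigfcupP; exists (x^-1 * y); last first.
  by apply/imfsetP; exists x; rewrite /= ?mulVKg // !inE mulVKg xK.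
rewrite andbT mem_cat; move: (xy : y \in cayley_nbr S x).
rewrite in_cayley_nbr => /andP[_].
case/orP => h; first by rewrite h.
by apply/orP; right; apply/mapP; exists (y^-1 * x); rewrite // invgM invgK.
Qed.

(** The generating sets are unrelated: [S'] being finite, its elements have
bounded length as words in [S], which costs only a constant factor. *)
Lemma cheeger_vertex_expansion (R : realType) S (genS : generates S)
    S' (genS' : generates S') :
  (0 < cheeger (cayley genS') R)%R ->
  exists2 e : R, (0 < e)%R & vertex_expansion (cayley genS) e.
Proof.
move=> h0.
have [n hn] :=
  sum_card_escaping_le genS ((S' : seq gT) ++ [seq s^-1 | s <- S']).
(* [n.+1] rather than [n], as [n] may be zero. *)
exists (cheeger (cayley genS') R / n.+1%:R)%R; first by rewrite divr_gt0.
move=> K; rewrite mulrAC ler_pdivrMr ?ltr0n // mulrC -natrM mulrC.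
apply: le_trans (cheeger_le R (K : {fset cayley genS'})) _.
rewrite ler_nat; apply: leq_trans (card_edge_boundary_le _) _.
by apply: leq_trans (hn K) _; rewrite mulnC leq_mul2l leqnSn orbT.
Qed.

End Cayley.

Theorem corollary8 (R : realType) (gT : groupType) :
  finitely_generated gT ->
  group_polynomial_containment gT R ->
  amenable gT R.
Proof.
move=> _ [d [S [genS contained]]] S' genS'; rewrite /amenable_graph.
have := cheeger_ge0 (cayley genS') R; rewrite le_eqVlt => /orP[/eqP->//|h0].
have [e e0 eS] := cheeger_vertex_expansion genS h0.
by case: (vertex_expansion_not_contained e0 eS contained).
Qed.
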